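(* Let $\Psi \subset \mathbb{R}^n$ be a minuscule system with respect to the simple system $\Delta \subset \mathbb{R}^n$, and let $A$ be the generalized Cartan matrix of $\Delta$, i.e. the $|\Delta|\times|\Delta|$ matrix with entries $A_{\mathbf a,\mathbf b} = 2\,\frac{\mathbf a\cdot\mathbf b}{\mathbf a\cdot\mathbf a}$ for $\mathbf a,\mathbf b\in\Delta$. Assume that $A$ is a symmetrizable generalized Cartan matrix, and let $\mathfrak g = \mathfrak g'(A)$ be the corresponding derived Kac--Moody algebra over $\mathbb{C}$, with generators $e_{\mathbf a}, f_{\mathbf a}, h_{\mathbf a}$ ($\mathbf a\in\Delta$). Then the $\mathbb{C}$-vector space $V_\Psi$ has the structure of a $\mathfrak g$-module, where for each $\mathbf a\in\Delta$ the generator $e_{\mathbf a}$ (respectively $f_{\mathbf a}$, $h_{\mathbf a}$) acts via the endomorphism $E_{\mathbf a}$ (respectively $F_{\mathbf a}$, $H_{\mathbf a}$) of $V_\Psi$.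
   Context: Minuscule systems: $\mathbb{R}^n$ carries the usual scalar product. Let $\Psi,\Delta\subset\mathbb{R}^n$ with $0\notin\Delta$. $\Psi$ is a minuscule system with respect to the simple system $\Delta$ if for every $\mathbf v\in\Psi$ and $\mathbf a\in\Delta$: (i) $2\,\mathbf v\cdot\mathbf a = c\,\mathbf a\cdot\mathbf a$ for some $c=c(\mathbf v,\mathbf a)\in\{-1,0,1\}$; (ii) $\mathbf v+\mathbf a\in\Psi$ if and only if $c=-1$, and $\mathbf v-\mathbf a\in\Psi$ if and only if $c=1$. Operators: $V_\Psi$ is the vector space (here over $\mathbb{C}$) with basis $\{b_{\mathbf v}:\mathbf v\in\Psi\}$. For $\mathbf a\in\Delta$ the linear endomorphisms $E_{\mathbf a},F_{\mathbf a},H_{\mathbf a}$ of $V_\Psi$ are defined by: $E_{\mathbf a}(b_{\mathbf v})=b_{\mathbf v+\mathbf a}$ if $\mathbf v+\mathbf a\in\Psi$ and $0$ otherwise; $F_{\mathbf a}(b_{\mathbf v})=b_{\mathbf v-\mathbf a}$ if $\mathbf v-\mathbf a\in\Psi$ and $0$ otherwise; $H_{\mathbf a}(b_{\mathbf v})=c(\mathbf v,\mathbf a)\,b_{\mathbf v}$. A square (finite) integer matrix $A=(a_{ij})$ is a generalized Cartan matrix if $a_{ii}=2$ for all $i$, $a_{ij}\le 0$ for $i\neq j$, and $a_{ij}=0\Rightarrow a_{ji}=0$. It is symmetrizable if $A=DB$ with $D$ an invertible diagonal matrix and $B$ symmetric. For $A$ symmetrizable, the derived Kac--Moody algebra $\mathfrak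 g'(A)$ is the Lie algebra over $\mathbb{C}$ generated by $e_i,f_i,h_i$ ($i$ in the index set of $A$) subject to the relations $[h_i,h_j]=0$, $[h_i,e_j]=A_{ij}e_j$, $[h_i,f_j]=-A_{ij}f_j$, $[e_i,f_j]=\delta_{ij}h_i$, and, for $i\ne j$, $(\mathrm{ad}\,e_i)^{1-A_{ij}}(e_j)=0$ and $(\mathrm{ad}\,f_i)^{1-A_{ij}}(f_j)=0$. *)

(* Defs.v *)
From HB Require Import structures.
From mathcomp Require Import all_boot all_order all_algebra finmap.
From mathcomp Require Import boolp classical_sets reals.
From mathcomp Require Import complex.
From mathcomp Require Import freeg.

Set Implicit Arguments.
Unset Strict Implicit.
Unset Printing Implicit Defensive.

Import Order.TTheory GRing.Theory Num.Theory.
Local Open Scope ring_scope.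
Local Open Scope quotient_scope.

HB.mixin Record Lmodule_isLieAlgebra (K : fieldType) L of GRing.Lmodule K L := {
  lie_br : L -> L -> L;
  lie_brl : forall y : L, linear (fun x => lie_br x y);
  lie_brr : forall x : L, linear (lie_br x);
  lie_brxx : forall x : L, lie_br x x = 0;
  lie_jacobi : forall x y z : L,
    lie_br x (lie_br y z) + lie_br y (lie_br z x) + lie_br z (lie_br x y) = 0
}.

#[short(type="lieAlgType")]
HB.structure Definition LieAlgebra (K : fieldType) :=
  { L of GRing.Lmodule K L & Lmodule_isLieAlgebra K L }.

Definition is_lie_hom (K : fieldType) (L M : lieAlgType K) (phi : L -> M) : Prop :=
  linear phi /\ forall x y, phi (lie_br x y) = lie_br (phi x) (phi y).

Definition is_lie_module (K : fieldType) (L : lieAlgType K) (V : lmodType K)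
    (act : L -> V -> V) : Prop :=
  [/\ forall v, linear (fun x => act x v),
      forall x, linear (act x)
    & forall x y v, act (lie_br x y) v = act x (act y v) - act y (act x v)].

(* The Lie algebra presented by generators [X] and relations: formal Lie
   expressions in [X], modulo the least congruence that contains the relations
   and the axioms of Lie algebras. [lie_pres_universal] below is its universal
   property. *)

Inductive lie_term (K X : Type) : Type :=
  | LGen of X
  | LZero
  | LOpp of lie_term K X
  | LAdd of lie_term K X & lie_term K X
  | LScale of K & lie_term K X
  | LBr of lie_term K X & lie_term K X.
Arguments LGen {K X}.
Arguments LZero {K X}.

HB.instance Definition _ (K X : Type) := gen_eqMixin (lie_term K X).
HB.instance Definition _ (K X : Type) := gen_choiceMixin (lie_term K X).

Section LiePresentation.
Context (K : fieldType) (X : Type).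
Context (rls : lie_term K X -> lie_term K X -> Prop).

Inductive lie_cong : lie_term K X -> lie_term K X -> Prop :=
  | lc_rel s t : rls s t -> lie_cong s t
  | lc_refl s : lie_cong s s
  | lc_sym s t : lie_cong s t -> lie_cong t s
  | lc_trans s t u : lie_cong s t -> lie_cong t u -> lie_cong s u
  | lc_opp s s' : lie_cong s s' -> lie_cong (LOpp s) (LOpp s')
  | lc_add s s' t t' : lie_cong s s' -> lie_cong t t' ->
      lie_cong (LAdd s t) (LAdd s' t')
  | lc_scale c s s' : lie_cong s s' -> lie_cong (LScale c s) (LScale c s')
  | lc_br s s' t t' : lie_cong s s' -> lie_cong t t' ->
      lie_cong (LBr s t) (LBr s' t')
  | lc_addA s t u : lie_cong (LAdd s (LAdd t u)) (LAdd (LAdd s t) u)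
  | lc_addC s t : lie_cong (LAdd s t) (LAdd t s)
  | lc_add0 s : lie_cong (LAdd LZero s) s
  | lc_addN s : lie_cong (LAdd (LOpp s) s) LZero
  | lc_scaleA a b s : lie_cong (LScale a (LScale b s)) (LScale (a * b) s)
  | lc_scale1 s : lie_cong (LScale 1 s) s
  | lc_scaleDr a s t :
      lie_cong (LScale a (LAdd s t)) (LAdd (LScale a s) (LScale a t))
  | lc_scaleDl a b s :
      lie_cong (LScale (a + b) s) (LAdd (LScale a s) (LScale b s))
  | lc_brl a s t u :
      lie_cong (LBr (LAdd (LScale a s) t) u) (LAdd (LScale a (LBr s u)) (LBr t u))
  | lc_brr a s t u :
      lie_cong (LBr u (LAdd (LScale a s) t)) (LAdd (LScale a (LBr u s)) (LBr u t))
  | lc_brxx s : lie_cong (LBr s s) LZero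
  | lc_jacobi s t u :
      lie_cong (LAdd (LAdd (LBr s (LBr t u)) (LBr t (LBr u s))) (LBr u (LBr s t)))
               LZero.

Definition lie_congb : rel (lie_term K X) := fun s t => `[< lie_cong s t >].

Lemma lie_congb_refl : reflexive lie_congb.
Proof. by move=> s; apply/asboolP; exact: lc_refl. Qed.

Lemma lie_congb_sym : symmetric lie_congb.
Proof. by move=> s t; apply/asboolP/asboolP; exact: lc_sym. Qed.

Lemma lie_congb_trans : transitive lie_congb.
Proof.
by move=> t s u /asboolP st /asboolP tu; apply/asboolP; exact: lc_trans st tu.
Qed.

Canonical lie_congb_equiv :=
  EquivRel lie_congb lie_congb_refl lie_congb_sym lie_congb_trans.

Definition lie_pres : Type := {eq_quot lie_congb}.
HB.instance Definition _ := Choice.on lie_pres.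
HB.instance Definition _ := Quotient.on lie_pres.

Definition lie_class (s : lie_term K X) : lie_pres := \pi_lie_pres s.

Lemma lie_classP s t : lie_class s = lie_class t <-> lie_cong s t.
Proof.
by split=> [/eqquotP/asboolP | /asboolP st] //; apply/eqquotP.
Qed.

Lemma lie_repr s : lie_cong (repr (lie_class s)) s.
Proof. by apply/lie_classP; rewrite /lie_class reprK. Qed.

Lemma lie_classW (P : lie_pres -> Prop) :
  (forall s, P (lie_class s)) -> forall x, P x.
Proof. by move=> Ps x; rewrite -[x]reprK; exact: Ps. Qed.

Definition lp_opp (x : lie_pres) := lie_class (LOpp (repr x)).
Definition lp_add (x y : lie_pres) := lie_class (LAdd (repr x) (repr y)).
Definition lp_scale c (x : lie_pres) := lie_class (LScale c (repr x)).
Definition lp_br (x y : lie_pres) := lie_class (LBr (repr x) (repr y)).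

Lemma lp_oppE s : lp_opp (lie_class s) = lie_class (LOpp s).
Proof. by apply/lie_classP/lc_opp/lie_repr. Qed.
Lemma lp_addE s t : lp_add (lie_class s) (lie_class t) = lie_class (LAdd s t).
Proof. by apply/lie_classP/lc_add; exact: lie_repr. Qed.
Lemma lp_scaleE c s : lp_scale c (lie_class s) = lie_class (LScale c s).
Proof. by apply/lie_classP/lc_scale/lie_repr. Qed.
Lemma lp_brE s t : lp_br (lie_class s) (lie_class t) = lie_class (LBr s t).
Proof. by apply/lie_classP/lc_br; exact: lie_repr. Qed.

Definition lpE := (lp_oppE, lp_addE, lp_scaleE, lp_brE).

Lemma lp_addA : associative lp_add.
Proof.
do 3![elim/lie_classW=> ?]; rewrite !lpE; exact/lie_classP/lc_addA.
Qed.
Lemma lp_addC : commutative lp_add.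
Proof. do 2![elim/lie_classW=> ?]; rewrite !lpE; exact/lie_classP/lc_addC. Qed.
Lemma lp_add0 : left_id (lie_class LZero) lp_add.
Proof. elim/lie_classW=> ?; rewrite !lpE; exact/lie_classP/lc_add0. Qed.
Lemma lp_addN : left_inverse (lie_class LZero) lp_opp lp_add.
Proof. elim/lie_classW=> ?; rewrite !lpE; exact/lie_classP/lc_addN. Qed.

HB.instance Definition _ :=
  GRing.isZmodule.Build lie_pres lp_addA lp_addC lp_add0 lp_addN.

Lemma lp_scaleA a b x : lp_scale a (lp_scale b x) = lp_scale (a * b) x.
Proof. elim/lie_classW: x => ?; rewrite !lpE; exact/lie_classP/lc_scaleA. Qed.
Lemma lp_scale1 : left_id 1 lp_scale.
Proof. elim/lie_classW=> ?; rewrite !lpE; exact/lie_classP/lc_scale1. Qed.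
Lemma lp_scaleDr : right_distributive lp_scale +%R.
Proof.
move=> a; do 2![elim/lie_classW=> ?]; rewrite /GRing.add /= !lpE.
exact/lie_classP/lc_scaleDr.
Qed.
Lemma lp_scaleDl x : {morph lp_scale^~ x : a b / a + b >-> a + b}.
Proof.
elim/lie_classW: x => ? a b; rewrite [in RHS]/GRing.add /= !lpE.
exact/lie_classP/lc_scaleDl.
Qed.

HB.instance Definition _ := GRing.Zmodule_isLmodule.Build K lie_pres
  lp_scaleA lp_scale1 lp_scaleDr lp_scaleDl.

Lemma lie_classD s t : lie_class (LAdd s t) = lie_class s + lie_class t.
Proof. by rewrite -lp_addE. Qed.
Lemma lie_classN s : lie_class (LOpp s) = - lie_class s.
Proof. by rewrite -lp_oppE. Qed.
Lemma lie_classZ c s : lie_class (LScale c s) = c *: lie_class s.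
Proof. by rewrite -lp_scaleE. Qed.

Lemma lp_brl y : linear (lp_br^~ y).
Proof.
move: y; elim/lie_classW=> u a; do 2![elim/lie_classW=> ?].
rewrite -lie_classZ -lie_classD !lpE -lie_classZ -lie_classD.
exact/lie_classP/lc_brl.
Qed.
Lemma lp_brr x : linear (lp_br x).
Proof.
move: x; elim/lie_classW=> u a; do 2![elim/lie_classW=> ?].
rewrite -lie_classZ -lie_classD !lpE -lie_classZ -lie_classD.
exact/lie_classP/lc_brr.
Qed.
Lemma lp_brxx x : lp_br x x = 0.
Proof. elim/lie_classW: x => ?; rewrite !lpE; exact/lie_classP/lc_brxx. Qed.
Lemma lp_jacobi x y z :
  lp_br x (lp_br y z) + lp_br y (lp_br z x) + lp_br z (lp_br x y) = 0.
Proof.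
elim/lie_classW: x => s; elim/lie_classW: y => t; elim/lie_classW: z => u.
rewrite !lpE -!lie_classD; exact/lie_classP/lc_jacobi.
Qed.

HB.instance Definition _ := Lmodule_isLieAlgebra.Build K lie_pres
  lp_brl lp_brr lp_brxx lp_jacobi.

Lemma lie_class_br s t : lie_class (LBr s t) = lie_br (lie_class s) (lie_class t).
Proof. by rewrite -lp_brE. Qed.

End LiePresentation.

Fixpoint lie_eval (K : fieldType) (X : Type) (L : lieAlgType K) (f : X -> L)
    (s : lie_term K X) : L :=
  match s with
  | LGen x => f x
  | LZero => 0
  | LOpp s => - lie_eval f s
  | LAdd s t => lie_eval f s + lie_eval f t
  | LScale c s => c *: lie_eval f s
  | LBr s t => lie_br (lie_eval f s) (lie_eval f t)
  end.

Lemma lie_pres_universal (K : fieldType) (X : Type)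
    (rls : lie_term K X -> lie_term K X -> Prop) (L : lieAlgType K) (f : X -> L) :
  (forall s t, rls s t -> lie_eval f s = lie_eval f t) ->
  exists! phi : lie_pres rls -> L,
    is_lie_hom phi /\ forall x, phi (lie_class rls (LGen x)) = f x.
Proof.
move=> frls.
have fcong s t : lie_cong rls s t -> lie_eval f s = lie_eval f t.
  elim=> //=.
  - by move=> ? ? ? _ -> _ ->.
  - by move=> ? ? _ ->.
  - by move=> ? ? ? ? _ -> _ ->.
  - by move=> ? ? ? _ ->.
  - by move=> ? ? ? ? _ -> _ ->.
  - by move=> *; rewrite addrA.
  - by move=> *; rewrite addrC.
  - by move=> *; rewrite add0r.
  - by move=> *; rewrite addNr.
  - by move=> *; rewrite scalerA.
  - by move=> *; rewrite scale1r.
  - by move=> *; rewrite scalerDr.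
  - by move=> *; rewrite scalerDl.
  - by move=> a x y z; rewrite (lie_brl (lie_eval f z)).
  - by move=> a x y z; rewrite (lie_brr (lie_eval f z)).
  - by move=> *; rewrite lie_brxx.
  - by move=> *; rewrite lie_jacobi.
pose phi (x : lie_pres rls) := lie_eval f (repr x).
have phiE s : phi (lie_class rls s) = lie_eval f s by exact/fcong/lie_repr.
exists phi; split.
  split=> [|x]; last by rewrite phiE.
  split=> [c|]; elim/lie_classW=> s; elim/lie_classW=> t.
    by rewrite -lie_classZ -lie_classD !phiE.
  by rewrite -lie_class_br !phiE.
move=> psi [[psil psib] psig]; apply/funext; elim/lie_classW=> s; rewrite phiE.
have psi0 : psi 0 = 0.
  by have := psil (-1) 0 0; rewrite addr0 scaler0 scaleN1r addNr.
have psiZ c x : psi (c *: x) = c *: psi x.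
  by have := psil c x 0; rewrite !addr0 psi0 addr0.
have psiD x y : psi (x + y) = psi x + psi y.
  by have := psil 1 x y; rewrite !scale1r.
elim: s => /= [x|||||].
- by rewrite psig.
- exact/esym.
- by move=> s ->; rewrite lie_classN -[in RHS]scaleN1r psiZ scaleN1r.
- by move=> s -> t ->; rewrite lie_classD psiD.
- by move=> c s ->; rewrite lie_classZ psiZ.
- by move=> s -> t ->; rewrite lie_class_br psib.
Qed.

Definition generalized_cartan (I : finType) (A : I -> I -> int) : Prop :=
  [/\ forall i, A i i = 2,
      forall i j, i != j -> A i j <= 0
    & forall i j, A i j = 0 -> A j i = 0].

Definition symmetrizable (K : fieldType) (I : finType) (A : I -> I -> int) : Prop :=
  exists (d : I -> K) (B : I -> I -> K),
    [/\ forall i, d i != 0,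
        forall i j, B i j = B j i
      & forall i j, (A i j)%:~R = d i * B i j].

Inductive km_gen (I : Type) : Type := KE of I | KF of I | KH of I.

Section DerivedKacMoody.
Context (K : fieldType) (I : finType) (A : I -> I -> int).

Local Notation e i := (@LGen K _ (KE i)).
Local Notation f i := (@LGen K _ (KF i)).
Local Notation h i := (@LGen K _ (KH i)).

(* For [i != j] the entry [A i j] of a generalized Cartan matrix is nonpositive,
   so the natural number [`|1 - A i j|] is [1 - A i j]. *)
Inductive km_rel : lie_term K (km_gen I) -> lie_term K (km_gen I) -> Prop :=
  | km_hh i j : km_rel (LBr (h i) (h j)) LZero
  | km_he i j : km_rel (LBr (h i) (e j)) (LScale (A i j)%:~R (e j))
  | km_hf i j : km_rel (LBr (h i) (f j)) (LScale (- (A i j)%:~R) (f j))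
  | km_ef i j : km_rel (LBr (e i) (f j)) (LScale (i == j)%:R (h i))
  | km_serre_e i j : i != j ->
      km_rel (iter `|1 - A i j|%N (LBr (e i)) (e j)) LZero
  | km_serre_f i j : i != j ->
      km_rel (iter `|1 - A i j|%N (LBr (f i)) (f j)) LZero.

Definition derived_km : lieAlgType K := lie_pres km_rel.

Definition km_e (i : I) : derived_km := lie_class km_rel (e i).
Definition km_f (i : I) : derived_km := lie_class km_rel (f i).
Definition km_h (i : I) : derived_km := lie_class km_rel (h i).

End DerivedKacMoody.

Section Minuscule.
Context (R : realType) (n : nat).
Implicit Types (Psi : set 'rV[R]_n) (Delta : {fset 'rV[R]_n}) (v a : 'rV[R]_n).

Definition dotv v a : R := \sum_(i < n) v 0 i * a 0 i.

Definition minuscule_system Psi Delta : Prop :=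
  0 \notin Delta /\
  forall v a, Psi v -> a \in Delta ->
    exists c : R,
      [/\ c \in [:: -1; 0; 1],
          2 * dotv v a = c * dotv a a,
          Psi (v + a) <-> c = -1
        & Psi (v - a) <-> c = 1].

(* The number [c] of [minuscule_system], which is unique because [a != 0]. *)
Definition minuscule_c v a : R := 2 * dotv v a / dotv a a.

Definition minuscule_space Psi : lmodType R[i] := {freeg (set_type Psi) / R[i]}.

Definition minuscule_basis Psi (v : Psi) : minuscule_space Psi := << v >>.

(* [b_v] if [v] is in [Psi], and [0] otherwise. *)
Definition minuscule_basis0 Psi v : minuscule_space Psi :=
  if insub v is Some w then minuscule_basis w else 0.

(* [fglift g] is the linear map that sends [<< v >>] to [g v]. *)
Definition minuscule_E Psi a : minuscule_space Psi -> minuscule_space Psi :=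
  fglift (fun v : Psi => minuscule_basis0 Psi (val v + a)).

Definition minuscule_F Psi a : minuscule_space Psi -> minuscule_space Psi :=
  fglift (fun v : Psi => minuscule_basis0 Psi (val v - a)).

Definition minuscule_H Psi a : minuscule_space Psi -> minuscule_space Psi :=
  fglift (fun v : Psi => (minuscule_c (val v) a)%:C%C *: minuscule_basis v).

End Minuscule.

Arguments minuscule_E {R n} Psi a.
Arguments minuscule_F {R n} Psi a.
Arguments minuscule_H {R n} Psi a.

(* Main.v *)
From HB Require Import structures.
Require Import Defs.
From mathcomp Require Import all_boot all_order all_algebra finmap.
From mathcomp Require Import boolp classical_sets functions reals.
From mathcomp Require Import complex.
From mathcomp Require Import freeg lra zify.
Import Order.TTheory GRing.Theory Num.Theory.
Local Open Scope ring_scope.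

(** By the universal property of a presented Lie algebra, a [g'(A)]-module
    structure on [V_Psi] is a choice of linear endomorphisms of [V_Psi] for the
    generators that satisfies the defining relations in the Lie algebra
    [gl(V_Psi)].

    The key observation is that the conditions on a simple root [a] are
    invariant under [a |-> - a], and that [F_a = E_(-a)]. So it suffices to
    study the operators [E_a] for vectors [a] such that [c(v, a)] is in
    [{-1, 0, 1}] for all weights [v], and [v + a] (resp. [v - a]) is a weight
    exactly when [c(v, a) = -1] (resp. [1]). As [c(-, a)] is additive with
    [c(a, a) = 2], evaluation on basis vectors gives:
    - [H_a E_b - E_b H_a = c(b, a) E_b] ([minuscule_HE]);
    - [E_a E_(-a) - E_(-a) E_a = H_a] ([minuscule_EF]);
    - [E_a] and [E_b] commute if [c(a, b), c(b, a) >= 0] ([minuscule_E_comm]):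
      if [v + a] and [v + a + b] are weights, then
      [c(v, b) = -1 - c(a, b) <= -1], so that [v + b] is a weight as well;
    - [E_a E_a = 0] ([minuscule_E_sq]), since along [v, v + a, v + 2 a] the
      value of [c(-, a)] would have to be [-1] both at [v] and at [v + a], while it
      increases by [2];
    - [E_a E_b E_a = 0] if [c(b, a) <> -2] ([minuscule_E_aba]): if the path
      [v, v + a, v + a + b, v + 2 a + b] consists of weights, then [c(-, a)]
      takes the value [-1] both at [v] and at [v + a + b], so that
      [2 + c(b, a) = 0].

    The commutation of [E_a] with [F_b] for [a <> b] is the third item for the
    vectors [a] and [- b]. For the Serre relations put [k = - c(b, a)]. If
    [k = 0], then also [c(a, b) = 0], and the relation is the commutation of
    [E_a] and [E_b], the third item. If [k = 1], then
    [ad(E_a)^2(E_b) = - 2 E_a E_b E_a = 0]. If [k >= 2], then already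
    [ad(E_a)^3 = 0] because [E_a E_a = 0]. *)

(** * The Lie algebra of linear endomorphisms of a vector space *)

Section LinearEndomorphisms.
Context (K : fieldType) (V : lmodType K).

Definition linear_endo_pred : {pred V -> V} := fun f => `[< linear f >].

(** The linear maps [V -> V], for [V] of arbitrary dimension. *)
Record linear_endo := LinearEndo {
  linear_endo_fun :> V -> V;
  _ : linear_endo_fun \in linear_endo_pred }.

HB.instance Definition _ := [isSub for linear_endo_fun].
HB.instance Definition _ := [Choice of linear_endo by <:].

Lemma linear_endo_submod_closed : submod_closed linear_endo_pred.
Proof.
split=> [|c f g /asboolP fl /asboolP gl]; apply/asboolP => a x y.
  by rewrite -[LHS]/(0 : V) -[RHS]/(a *: (0 : V) + 0) scaler0 addr0.
rewrite -[LHS]/(c *: f (a *: x + y) + g (a *: x + y)).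
rewrite fl gl !scalerDr !scalerA (mulrC c a).
by rewrite addrACA.
Qed.

HB.instance Definition _ :=
  GRing.isSubmodClosed.Build _ _ linear_endo_pred linear_endo_submod_closed.
HB.instance Definition _ := [SubChoice_isSubLmodule of linear_endo by <:].

Definition mk_endo (f : V -> V) (fl : linear f) : linear_endo :=
  LinearEndo f (introT (asboolP _) fl).

Lemma endoP (x : linear_endo) : linear x.
Proof. exact/asboolP/(valP x). Qed.

Lemma endo_ext (x y : linear_endo) : x =1 y -> x = y.
Proof. by move=> xy; apply/val_inj/funext. Qed.

Lemma endo0 (x : linear_endo) : x 0 = 0.
Proof. by have := endoP x (-1) 0 0; rewrite scaler0 addr0 scaleN1r addNr. Qed.

Lemma endoZ (x : linear_endo) c v : x (c *: v) = c *: x v.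
Proof. by have := endoP x c v 0; rewrite !addr0 endo0 addr0. Qed.

Lemma endoD (x : linear_endo) u v : x (u + v) = x u + x v.
Proof. by have := endoP x 1 u v; rewrite !scale1r. Qed.

Lemma endoB (x : linear_endo) u v : x (u - v) = x u - x v.
Proof. by rewrite endoD -[- v]scaleN1r endoZ scaleN1r. Qed.

Lemma endo_comp_linear (x y : linear_endo) : linear (x \o y).
Proof. by move=> c u v /=; rewrite !endoP. Qed.

Definition endo_comp (x y : linear_endo) : linear_endo :=
  mk_endo _ (endo_comp_linear x y).

(** The commutator of two linear endomorphisms. *)
Definition endo_br (x y : linear_endo) : linear_endo :=
  endo_comp x y - endo_comp y x.

Lemma endo_brl (y : linear_endo) : linear (fun x => endo_br x y).
Proof.
move=> c x x'; apply: endo_ext => v.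
rewrite -[LHS]/(c *: x (y v) + x' (y v) - y (c *: x v + x' v)).
by rewrite endoP opprD addrACA -scalerBr.
Qed.

Lemma endo_brr (x : linear_endo) : linear (endo_br x).
Proof.
move=> c y y'; apply: endo_ext => v.
rewrite -[LHS]/(x (c *: y v + y' v) - (c *: y (x v) + y' (x v))).
by rewrite endoP opprD addrACA -scalerBr.
Qed.

Lemma endo_brxx (x : linear_endo) : endo_br x x = 0.
Proof. by apply: endo_ext => v; rewrite /endo_br subrr. Qed.

Lemma endo_jacobi (x y z : linear_endo) :
  endo_br x (endo_br y z) + endo_br y (endo_br z x) + endo_br z (endo_br x y) = 0.
Proof.
apply: endo_ext => v.
rewrite -[LHS]/((x (y (z v) - z (y v)) - (y (z (x v)) - z (y (x v))))
  + (y (z (x v) - x (z v)) - (z (x (y v)) - x (z (y v))))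
  + (z (x (y v) - y (x v)) - (x (y (z v)) - y (x (z v))))).
rewrite !endoB !opprB !addrA !subrK.
rewrite (ACl ((1*8)*(2*5)*(3*6)*(4*7))) /=.
by rewrite !subrr !addNr !addr0.
Qed.

HB.instance Definition _ := Lmodule_isLieAlgebra.Build K linear_endo
  endo_brl endo_brr endo_brxx endo_jacobi.

End LinearEndomorphisms.


Section Adjoint.
Context (K : fieldType) (V : lmodType K).
Implicit Types x y : linear_endo K V.

Lemma endo_brE x y v : lie_br x y v = x (y v) - y (x v).
Proof. by []. Qed.

Lemma endo_scaleE c x v : (c *: x) v = c *: x v.
Proof. by []. Qed.

Lemma endo_zeroE v : (0 : linear_endo K V) v = 0.
Proof. by []. Qed.

(** If [x x = 0] and [x y x = 0], then [ad(x)^2(y) = - 2 x y x] vanishes. *)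
Lemma endo_ad2_eq0 x y :
  (forall v, x (x v) = 0) -> (forall v, x (y (x v)) = 0) ->
  lie_br x (lie_br x y) = 0.
Proof.
move=> xx xyx; apply: endo_ext => v.
by rewrite !endo_brE endoB !xx xyx endo0 !subr0.
Qed.

(** If [x x = 0], then every term of the expansion of [ad(x)^3(y)] contains
    [x x]. *)
Lemma endo_ad3_eq0 x y :
  (forall v, x (x v) = 0) -> lie_br x (lie_br x (lie_br x y)) = 0.
Proof.
move=> xx; apply: endo_ext => v.
by rewrite !endo_brE !endoB !xx !endo0 !(subr0, sub0r, addr0, endo0, oppr0).
Qed.

Lemma iter_lie_br0 (L : lieAlgType K) (x : L) k : iter k (lie_br x) 0 = 0.
Proof.
elim: k => //= k ->; have := lie_brr x (-1) 0 0.
by rewrite scaler0 addr0 scaleN1r addNr.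
Qed.

End Adjoint.

(** * Linear maps out of a free module *)

Section FreeModule.
Context (K : fieldType) (X : choiceType) (V : lmodType K).

Lemma fglift_linear (f : X -> V) : linear (fglift f : {freeg X / K} -> V).
Proof.
pose g := fglift f : {freeg X / K} -> V.
have gB u v : g (u - v) = g u - g v by exact: lift_is_additive.
have g0 : g 0 = 0 by rewrite -[in LHS](subrr 0) gB subrr.
have gD u v : g (u + v) = g u + g v.
  have gN w : g (- w) = - g w by rewrite -[in LHS]sub0r gB g0 sub0r.
  by rewrite -[in LHS](opprK v) gB gN opprK.
have gZU c k x : g (c *: << k *g x >>) = c *: g << k *g x >>.
  suff -> : c *: << k *g x >> = << (c * k) *g x >> :> {freeg X / K}.
    by rewrite /g !liftU scalerA.
  by apply/eqP/freeg_eqP => y; rewrite coeffZ !coeffU mulrA.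
have gZ c v : g (c *: v) = c *: g v.
  elim/freeg_ind_dom0: v => [|k x v _ _ IH]; first by rewrite scaler0 g0 scaler0.
  by rewrite scalerDr !gD gZU IH scalerDr.
by move=> c u v; rewrite -/g gD gZ.
Qed.

Lemma freeg_linear_ext (f g : linear_endo K {freeg X / K}) :
  (forall x, f << x >> = g << x >>) -> f = g.
Proof.
move=> fg; apply: endo_ext; elim/freeg_ind_dom0 => [|k x v _ _ IH].
  by rewrite !endo0.
suff -> : << k *g x >> = k *: << x >> :> {freeg X / K}.
  by rewrite !endoD !endoZ fg IH.
by apply/eqP/freeg_eqP => y; rewrite coeffZ !coeffU mul1r.
Qed.

End FreeModule.

(** * The operators of a minuscule system *)

Section MinusculeOperators.
Context (R : realType) (n : nat).
Implicit Types (v a b : 'rV[R]_n).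

Lemma dotvC v a : dotv v a = dotv a v.
Proof. by apply: eq_bigr => i _; rewrite mulrC. Qed.

Lemma dotvDl v w a : dotv (v + w) a = dotv v a + dotv w a.
Proof.
by rewrite /dotv -big_split; apply: eq_bigr => i _; rewrite mxE mulrDl.
Qed.

Lemma dotvNl v a : dotv (- v) a = - dotv v a.
Proof. by rewrite /dotv -sumrN; apply: eq_bigr => i _; rewrite mxE mulNr. Qed.

Lemma dotvNr v a : dotv v (- a) = - dotv v a.
Proof. by rewrite dotvC dotvNl dotvC. Qed.

Lemma dotvv_eq0 a : (dotv a a == 0) = (a == 0).
Proof.
apply/eqP/eqP => [aa0|->]; last first.
  by rewrite /dotv big1 // => i _; rewrite mxE mul0r.
have sq_ge0 (i : 'I_n) : true -> 0 <= a 0 i * a 0 i.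
  by move=> _; rewrite -expr2 sqr_ge0.
apply/rowP => i; rewrite mxE; apply/eqP.
have /eqP : a 0 i * a 0 i = 0 by exact: (psumr_eq0P sq_ge0 aa0).
by rewrite mulf_eq0 orbb.
Qed.

Lemma minuscule_cDl v w a :
  minuscule_c (v + w) a = minuscule_c v a + minuscule_c w a.
Proof. by rewrite /minuscule_c dotvDl mulrDr mulrDl. Qed.

Lemma minuscule_cNl v a : minuscule_c (- v) a = - minuscule_c v a.
Proof. by rewrite /minuscule_c dotvNl mulrN mulNr. Qed.

Lemma minuscule_cNr v a : minuscule_c v (- a) = - minuscule_c v a.
Proof. by rewrite /minuscule_c dotvNl !dotvNr opprK mulrN mulNr. Qed.

Lemma minuscule_caa a : a != 0 -> minuscule_c a a = 2.
Proof. by move=> a0; rewrite /minuscule_c mulfK // dotvv_eq0. Qed.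

Context (Psi : set 'rV[R]_n).

(** The conditions that a minuscule system imposes on a simple root, without
    any reference to the other simple roots. Unlike a simple system, the set of
    these vectors is stable under negation. *)
Definition minuscule_root a : Prop :=
  a != 0 /\ forall v, Psi v ->
    [/\ minuscule_c v a \in [:: -1; 0; 1],
        Psi (v + a) <-> minuscule_c v a = -1
      & Psi (v - a) <-> minuscule_c v a = 1].

Lemma minuscule_system_root (Delta : {fset 'rV[R]_n}) a :
  minuscule_system Psi Delta -> a \in Delta -> minuscule_root a.
Proof.
move=> [D0 PD] aD.
have a0 : a != 0 by apply: contraNneq D0 => <-.
split=> // v Pv; have [c [c_in vac cD cB]] := PD v a Pv aD.
suff -> : minuscule_c v a = c by [].
by rewrite /minuscule_c vac mulfK // dotvv_eq0.
Qed.

Lemma minuscule_rootN a : minuscule_root a -> minuscule_root (- a).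
Proof.
move=> [a0 Pa]; split=> [|v Pv]; first by rewrite oppr_eq0.
have [c_in cD cB] := Pa v Pv; rewrite minuscule_cNr opprK; split.
- by move: c_in; rewrite !inE !eqr_oppLR opprK oppr0 => /or3P[]->; rewrite ?orbT.
- by rewrite cB; split=> [->|/oppr_inj].
- by rewrite cD; split=> [->|/eqP]; rewrite ?opprK // eqr_oppLR => /eqP.
Qed.

Lemma minuscule_c_bounds v a :
  minuscule_root a -> Psi v -> -1 <= minuscule_c v a <= 1.
Proof.
move=> [_ Pa] /Pa[+ _ _]; rewrite !inE => /or3P[]/eqP->; lra.
Qed.

Lemma minuscule_rootD v a :
  minuscule_root a -> Psi v -> Psi (v + a) <-> minuscule_c v a = -1.
Proof. by move=> [_ Pa] /Pa[]. Qed.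

Local Notation VPsi := (minuscule_space Psi).
Local Notation bas := (minuscule_basis0 Psi).

Lemma minuscule_basis0_in (w : Psi) : bas (val w) = << w >>.
Proof. by rewrite /minuscule_basis0 valK. Qed.

Lemma minuscule_basis0_out v : ~ Psi v -> bas v = 0.
Proof.
move=> nPv; rewrite /minuscule_basis0; case: insubP => // w /set_mem.
by move/nPv.
Qed.

Definition minuscule_E_endo a : linear_endo R[i] VPsi :=
  mk_endo _ _ (minuscule_E Psi a) (fglift_linear _ _ _ _).

Definition minuscule_F_endo a : linear_endo R[i] VPsi :=
  mk_endo _ _ (minuscule_F Psi a) (fglift_linear _ _ _ _).

Definition minuscule_H_endo a : linear_endo R[i] VPsi :=
  mk_endo _ _ (minuscule_H Psi a) (fglift_linear _ _ _ _).

(** As [v - a] is [v + (- a)], the operator [F_a] is [E_(-a)]. *)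
Lemma minuscule_F_endoE a : minuscule_F_endo a = minuscule_E_endo (- a).
Proof. by []. Qed.

Local Notation E := minuscule_E_endo.
Local Notation H := minuscule_H_endo.

Lemma minuscule_endo_ext (x y : linear_endo R[i] VPsi) :
  (forall v, Psi v -> x (bas v) = y (bas v)) -> x = y.
Proof.
move=> xy; apply: freeg_linear_ext => w; rewrite -minuscule_basis0_in.
exact/xy/set_mem/valP.
Qed.

Lemma minuscule_weightP v : Psi v -> exists w : Psi, v = val w.
Proof. by move=> /mem_set Pv; exists (Sub v Pv); rewrite SubK. Qed.

Lemma minuscule_E_basis v a : Psi v -> E a (bas v) = bas (v + a).
Proof.
move=> /minuscule_weightP[w ->]; rewrite minuscule_basis0_in /=.
by rewrite /minuscule_E liftU scale1r.
Qed.

Lemma minuscule_H_basis v a : H a (bas v) = (minuscule_c v a)%:C%C *: bas v.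
Proof.
have [/minuscule_weightP[w ->]|nPv] := pselect (Psi v); last first.
  by rewrite minuscule_basis0_out // endo0 scaler0.
by rewrite minuscule_basis0_in /= /minuscule_H liftU scale1r.
Qed.

Lemma minuscule_HH a b : lie_br (H a) (H b) = 0.
Proof.
apply: minuscule_endo_ext => v _; rewrite endo_brE !(minuscule_H_basis, endoZ).
by rewrite !scalerA mulrC subrr.
Qed.

Lemma minuscule_HE a b :
  lie_br (H a) (E b) = (minuscule_c b a)%:C%C *: E b.
Proof.
apply: minuscule_endo_ext => v Pv; rewrite endo_brE endo_scaleE.
rewrite minuscule_H_basis endoZ minuscule_E_basis // minuscule_H_basis -scalerBl.
by rewrite minuscule_cDl rmorphD /= addrAC subrr add0r.
Qed.

Lemma minuscule_EF a : minuscule_root a -> lie_br (E a) (E (- a)) = H a.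
Proof.
move=> ra; have rNa := minuscule_rootN _ ra.
apply: minuscule_endo_ext => v Pv.
rewrite endo_brE minuscule_H_basis (minuscule_E_basis v) // (minuscule_E_basis v) //.
have [_ /(_ v Pv)[c_in cD cB]] := ra.
have EE b : Psi (v + b) -> E (- b) (bas (v + b)) = bas v.
  by move=> /minuscule_E_basis->; rewrite addrK.
have EE0 b : ~ Psi (v + b) -> E (- b) (bas (v + b)) = 0.
  by move=> /minuscule_basis0_out->; rewrite endo0.
have EEN := EE (- a); have EE0N := EE0 (- a); rewrite opprK in EEN EE0N.
move: c_in; rewrite !inE => /or3P[]/eqP c_v; rewrite c_v.
- rewrite EE0N; last by rewrite cB c_v => h; lra.
  by rewrite EE ?cD // sub0r rmorphN1 scaleN1r.
- rewrite EE0N; last by rewrite cB c_v => h; lra.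
  rewrite EE0; last by rewrite cD c_v => h; lra.
  by rewrite subrr scale0r.
- rewrite EEN ?cB // EE0; last by rewrite cD c_v => h; lra.
  by rewrite subr0 scale1r.
Qed.

Lemma minuscule_EE v a b : Psi v ->
  E b (E a (bas v)) = if `[< Psi (v + a) >] then bas (v + a + b) else 0.
Proof.
move=> Pv; rewrite minuscule_E_basis //; case: asboolP => [Pva|nPva].
  by rewrite minuscule_E_basis.
by rewrite minuscule_basis0_out // endo0.
Qed.

(** One path from [v] to [v + a + b] inside [Psi] yields the other. *)
Lemma minuscule_square v a b : minuscule_root a -> minuscule_root b ->
  0 <= minuscule_c a b -> Psi v -> Psi (v + a) -> Psi (v + a + b) ->
  Psi (v + b).
Proof.
move=> ra rb cab Pv Pva /(minuscule_rootD _ _ rb Pva).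
rewrite minuscule_cDl => c_ab; apply/(minuscule_rootD _ _ rb Pv).
by have := minuscule_c_bounds _ _ rb Pv; lra.
Qed.

Lemma minuscule_E_comm a b : minuscule_root a -> minuscule_root b ->
  0 <= minuscule_c a b -> 0 <= minuscule_c b a ->
  lie_br (E a) (E b) = 0.
Proof.
move=> ra rb cab cba; apply: minuscule_endo_ext => v Pv.
rewrite endo_brE endo_zeroE !minuscule_EE // (addrAC v a b).
have [Pvba|nPvba] := pselect (Psi (v + b + a)); last first.
  by rewrite !minuscule_basis0_out //; do 2![case: asboolP]; rewrite subrr.
suff -> : `[< Psi (v + b) >] = `[< Psi (v + a) >] by rewrite subrr.
apply/asboolP/asboolP => Pw.
  exact: (minuscule_square _ _ _ rb ra).
by apply: (minuscule_square _ _ _ ra rb) => //; rewrite addrAC.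
Qed.

Lemma minuscule_E_sq a x : minuscule_root a -> E a (E a x) = 0.
Proof.
move=> ra; have aa := minuscule_caa _ ra.1.
suff /(congr1 (fun z : linear_endo _ _ => z x)) :
  endo_comp _ _ (E a) (E a) = 0 by [].
apply: minuscule_endo_ext => v Pv; rewrite -[LHS]/(E a (E a (bas v))) minuscule_EE //.
case: asboolP => // Pva; apply: minuscule_basis0_out.
move=> /(minuscule_rootD _ _ ra Pva); rewrite minuscule_cDl aa.
by have := (minuscule_rootD _ _ ra Pv).1 Pva; lra.
Qed.

Lemma minuscule_E_aba a b x : minuscule_root a -> minuscule_c b a != -2 ->
  E a (E b (E a x)) = 0.
Proof.
move=> ra /eqP cba; have aa := minuscule_caa _ ra.1.
suff /(congr1 (fun z : linear_endo _ _ => z x)) :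
  endo_comp _ _ (E a) (endo_comp _ _ (E b) (E a)) = 0 by [].
apply: minuscule_endo_ext => v Pv; rewrite -[LHS]/(E a (E b (E a (bas v)))) minuscule_EE //.
case: asboolP => [Pva|_]; last exact: endo0.
have [Pvab|nPvab] := pselect (Psi (v + a + b)); last first.
  by rewrite minuscule_basis0_out // endo0.
rewrite minuscule_E_basis //; apply: minuscule_basis0_out.
move=> /(minuscule_rootD _ _ ra Pvab); rewrite !minuscule_cDl aa.
by have := (minuscule_rootD _ _ ra Pv).1 Pva; lra.
Qed.

(** The Serre relation for any two vectors with the properties of simple
    roots: with [a], [b] simple it is the relation for the [e]s, and with their
    negatives the relation for the [f]s. *)
Lemma minuscule_serre a b (A : int) : minuscule_root a -> minuscule_root b ->
  minuscule_c b a = A%:~R -> A <= 0 -> (A = 0 -> minuscule_c a b = 0) ->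
  iter `|1 - A|%N (lie_br (E a)) (E b) = 0.
Proof.
move=> ra rb cba A_le0 cab; have sq x := minuscule_E_sq _ x ra.
case: A A_le0 cba cab => [|k] // => [[|//] _ cba cab|_ cba _].
  by apply: minuscule_E_comm; rewrite ?cab ?cba.
have -> : `|1 - Negz k|%N = k.+2 by lia.
case: k cba => [|k] cba.
  apply: endo_ad2_eq0 => // x; apply: minuscule_E_aba => //.
  by rewrite cba; apply/eqP; lra.
rewrite -addn3 iterD /= endo_ad3_eq0 //; exact: iter_lie_br0.
Qed.

End MinusculeOperators.

(** * The module structure *)

Lemma lie_eval_iter_br (K : fieldType) (X : Type) (L : lieAlgType K)
    (f : X -> L) m s t :
  lie_eval f (iter m (LBr s) t) =
  iter m (lie_br (lie_eval f s)) (lie_eval f t).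
Proof. by elim: m => //= m ->. Qed.

(** The images in [gl(V_Psi)] of the generators of [g'(A)]. *)
Definition minuscule_generator (R : realType) (n : nat) (Psi : set 'rV[R]_n)
    (Delta : {fset 'rV[R]_n}) (g : km_gen Delta) :
    linear_endo R[i] (minuscule_space Psi) :=
  match g with
  | KE a => minuscule_E_endo R n Psi (val a)
  | KF a => minuscule_F_endo R n Psi (val a)
  | KH a => minuscule_H_endo R n Psi (val a)
  end.

Theorem theorem3p2 (R : realType) (n : nat)
    (Psi : set 'rV[R]_n) (Delta : {fset 'rV[R]_n})
    (A : Delta -> Delta -> int) :
  minuscule_system Psi Delta ->
  (forall a b : Delta,
     (A a b)%:~R = 2 * (dotv (val a) (val b) / dotv (val a) (val a))) ->
  generalized_cartan A ->
  symmetrizable R[i] A ->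
  exists act : derived_km R[i] A -> minuscule_space Psi -> minuscule_space Psi,
    is_lie_module act /\
    forall a : Delta,
      [/\ act (km_e R[i] A a) =1 minuscule_E Psi (val a),
          act (km_f R[i] A a) =1 minuscule_F Psi (val a)
        & act (km_h R[i] A a) =1 minuscule_H Psi (val a)].
Proof.
move=> mPD AE [A2 A_le0 A_eq0] _.
have r (a : Delta) : minuscule_root R n Psi (val a).
  exact: minuscule_system_root mPD (valP a).
have rN (a : Delta) : minuscule_root R n Psi (- val a).
  exact: minuscule_rootN.
have cE (a b : Delta) : minuscule_c (val b) (val a) = (A a b)%:~R.
  by rewrite /minuscule_c AE dotvC mulrA.
have cNE (a b : Delta) : minuscule_c (- val b) (- val a) = (A a b)%:~R.
  by rewrite minuscule_cNl minuscule_cNr opprK cE.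
have cEC (a b : Delta) : (minuscule_c (val b) (val a))%:C%C = (A a b)%:~R :> R[i].
  by rewrite cE rmorph_int.
have c_ge0 (a b : Delta) : a != b -> 0 <= minuscule_c (- val b) (val a).
  by move=> ab; rewrite minuscule_cNl cE oppr_ge0 lerz0 A_le0.
have c_ge0' (a b : Delta) : a != b -> 0 <= minuscule_c (val b) (- val a).
  by move=> ab; rewrite minuscule_cNr cE oppr_ge0 lerz0 A_le0.
have relsE s t : km_rel A s t ->
    lie_eval (minuscule_generator R n Psi Delta) s =
    lie_eval (minuscule_generator R n Psi Delta) t.
  case=> [a b|a b|a b|a b|a b ab|a b ab] /=.
  - exact: minuscule_HH.
  - by rewrite minuscule_HE cEC.
  - by rewrite minuscule_F_endoE -cEC -rmorphN -minuscule_cNl -minuscule_HE.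
  - rewrite minuscule_F_endoE; have [<-|ab] := eqVneq a b.
      by rewrite scale1r; exact: minuscule_EF (r a).
    rewrite scale0r.
    apply: (minuscule_E_comm _ _ _ _ _ (r a) (rN b)); last exact: (c_ge0 a b).
    by apply: (c_ge0' b a); rewrite eq_sym.
  - rewrite lie_eval_iter_br /=.
    apply: (minuscule_serre _ _ _ _ _ _ (r a) (r b) (cE a b)).
      exact: A_le0.
    by move=> /A_eq0 Aba; rewrite -[LHS]/(minuscule_c (val a) (val b)) cE Aba.
  - rewrite lie_eval_iter_br /= !minuscule_F_endoE.
    apply: (minuscule_serre _ _ _ _ _ _ (rN a) (rN b) (cNE a b)).
      exact: A_le0.
    by move=> /A_eq0 Aba;
      rewrite -[LHS]/(minuscule_c (- val a) (- val b)) cNE Aba.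
have [phi [[[phi_lin phi_br] phi_gen] _]] := lie_pres_universal relsE.
exists (fun x v => (phi x : linear_endo _ _) v); split; last first.
  by move=> a; split=> v; rewrite phi_gen.
split=> [v c x y|x|x y v]; first by rewrite phi_lin.
  exact: endoP.
by rewrite phi_br.
Qed.
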